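(* Let $p>1$, let $\Gamma$ be a connected simple graph with $N$ vertices, and let $F=\{f_i\}_{i=1}^N$ be an $(N-1)$-independent $\mathcal{L}_\Gamma(N,N-1)$-frame for $\mathbb{C}^{N-1}$. Let $c_1,\dots,c_N\in\mathbb{C}$, not all zero, be such that $\sum_{i=1}^N c_if_i=0$. Then $$\mathcal{E}_1^p(F,S_F^{-1}F)=\Big\{\frac1N\sum_{i=1}^N\Big(1-\frac{c_i^2}{c_1^2+c_2^2+\cdots+c_N^2}\Big)^p\Big\}^{1/p}.$$
   Context: A sequence $F=\{f_i\}_{i=1}^N$ in an $n$-dimensional Hilbert space $\mathcal{H}$ is a frame if there are $A,B>0$ with $A\|f\|^2\le\sum_{i=1}^N|\langle f,f_i\rangle|^2\le B\|f\|^2$ for all $f\in\mathcal{H}$. Its analysis operator is $\Theta_F f=(\langle f,f_i\rangle)_{i=1}^N$, with adjoint $\Theta_F^*(c_i)_i=\sum_i c_if_i$; the frame operator is $S_F=\Theta_F^*\Theta_F$ (positive and invertible), and $S_F^{-1}F=\{S_F^{-1}f_i\}_{i=1}^N$ is the canonical dual. A frame is $k$-independent if any $k$ of its vectors are linearly independent. Let $\mathcal{D}^{(1)}$ be the set of $N\times N$ diagonal matrices with exactly one diagonal entry equal to $1$ and all others $0$; $\rho$ is the spectral radius. For frames $F$ and $G$ with $G$ a dual of $F$ (i.e. $f=\sum_i\langle f,f_i\rangle g_i$ for all $f$), define $\mathcal{E}_1^p(F,G)=\Big\{\frac1N\sum_{D\in\mathcal{D}^{(1)}}\big(\rho(\Theta_G^*D\Theta_F)\big)^p\Big\}^{1/p}$.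 (Superscript $p$ in $\mathcal{E}_1^p$ is an index, not a power.) For a simple graph $\Gamma$ on vertices $v_1,\dots,v_N$, the Laplacian is $\mathcal{L}(\Gamma)=\mathcal{D}(\Gamma)-\mathcal{A}(\Gamma)$, with $\mathcal{D}(\Gamma)$ the diagonal degree matrix and $\mathcal{A}(\Gamma)$ the adjacency matrix. If $\Gamma$ has $N-n$ connected components, write $\mathcal{L}(\Gamma)=M\,\mathrm{diag}(\lambda_1,\dots,\lambda_n,0,\dots,0)M^*$ with $\lambda_1,\dots,\lambda_n$ the nonzero eigenvalues and $M$ a unitary matrix of corresponding eigenvectors; let $M_1$ consist of the first $n$ columns of $M$ and $B=\mathrm{diag}(\sqrt{\lambda_1},\dots,\sqrt{\lambda_n})M_1^*$. Any frame of the form $\{Be_i\}_{i=1}^N$, with $(e_i)$ the standard basis of $\mathbb{C}^N$, is called an $\mathcal{L}_\Gamma(N,n)$-frame; its Gramian matrix $\Theta_F\Theta_F^*$ is $\mathcal{L}(\Gamma)$. *)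

(* Defs.v *)
From HB Require Import structures.
From mathcomp Require Export all_boot all_order all_algebra.
From mathcomp Require Export complex.
From mathcomp Require Export all_classical all_reals all_analysis.

Set Implicit Arguments.
Unset Strict Implicit.
Unset Printing Implicit Defensive.

Import Order.TTheory GRing.Theory Num.Theory.
Import Num.Def.

Local Open Scope classical_set_scope.
Local Open Scope sesquilinear_scope.
Local Open Scope ring_scope.

Section ComplexPower.
Variable R : realType.
Implicit Types (z : R[i]) (p : R).

Definition modulus z : R := complex.Re `|z|.

Definition carg z : R :=
  if 0 <= complex.Im z then acos (complex.Re z / modulus z)
  else - acos (complex.Re z / modulus z).

(* Principal value of z^p for a real exponent p: the analysis library only has
   [powR], whose base is real. On nonnegative reals it agrees with [powR]. *)
Definition cpow z p : R[i] :=
  Complex (modulus z `^ p * cos (p * carg z)) (modulus z `^ p * sin (p * carg z)).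

End ComplexPower.

Section Frames.
Variables (R : realType) (N n : nat).
Implicit Types (F G : 'I_N -> 'cV[R[i]]_n) (f g : 'cV[R[i]]_n).

(* The inner product of C^n, linear in the first argument. *)
Definition dot f g : R[i] := \sum_(k < n) f k 0 * (g k 0)^*.

Definition is_frame F :=
  exists A B : R, [/\ 0 < A, 0 < B & forall f,
    (A%:C)%C * dot f f <= \sum_(i < N) `|dot f (F i)| ^+ 2
                       <= (B%:C)%C * dot f f].

(* Matrix, in the standard bases, of f |-> (<f, f_i>)_i. *)
Definition analysis_mx F : 'M[R[i]]_(N, n) := \matrix_(i, k) (F i k 0)^*.

Definition frame_op F : 'M[R[i]]_n := (analysis_mx F)^t* *m analysis_mx F.

Definition canonical_dual F : 'I_N -> 'cV[R[i]]_n :=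
  fun i => invmx (frame_op F) *m F i.

(* Independence is that of the subfamily, so repeated vectors count. *)
Definition k_independent (k : nat) F :=
  forall I : {set 'I_N}, #|I| = k -> free [seq F i | i in I].

(* The supremum is a maximum, and is 0 when n = 0. *)
Definition spectral_radius (A : 'M[R[i]]_n) : R :=
  sup [set modulus a | a in [set a | eigenvalue A a]].

Definition D1 : set 'M[R[i]]_N := [set delta_mx i i | i in [set: 'I_N]].

Definition E1 (p : R) F G : R :=
  (N%:R^-1 * \sum_(D \in D1)
     spectral_radius ((analysis_mx G)^t* *m D *m analysis_mx F) `^ p) `^ p^-1.

End Frames.

Section GraphFrames.
Variables (R : realType) (N : nat).
Implicit Types e : rel 'I_N.

Definition graph_components e : nat := n_comp e 'I_N.

Definition graph_connected e := graph_components e = 1.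

Definition degree e (i : 'I_N) : nat := #|[set j | e i j]%SET|.

Definition degree_mx e : 'M[R[i]]_N := diag_mx (\row_i (degree e i)%:R).

Definition adjacency_mx e : 'M[R[i]]_N := \matrix_(i, j) (e i j)%:R.

Definition laplacian e : 'M[R[i]]_N := degree_mx e - adjacency_mx e.

(* lam lists lambda_1, ..., lambda_n, 0, ..., 0; [colsub (widen_ord le_nN)]
   keeps the first n columns. *)
Definition is_laplacian_frame n e (F : 'I_N -> 'cV[R[i]]_n) :=
  [/\ is_frame F,
      (n + graph_components e)%N = N
    & exists (le_nN : (n <= N)%N) (lam : 'rV[R[i]]_N) (M : 'M[R[i]]_N),
      let first_cols m (A : 'M[R[i]]_(m, N)) := colsub (widen_ord le_nN) A in
      [/\ forall j : 'I_N, (lam 0 j != 0) = (j < n)%N,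
          M \is unitarymx,
          laplacian e = M *m diag_mx lam *m M^t*
        & forall i : 'I_N,
            F i = diag_mx (map_mx sqrtC (first_cols 1 lam))
                  *m (first_cols N M)^t* *m delta_mx i 0]].

End GraphFrames.

(* Main.v *)
Require Import Defs.

Set Implicit Arguments.
Unset Strict Implicit.
Unset Printing Implicit Defensive.

Import Order.TTheory GRing.Theory Num.Theory.

(** Both sides of the formula equal [1 - N^-1].

    The all-ones vector lies in the kernel of the Laplacian of any graph
    ([laplacian_const]), so the vectors of a Laplacian frame sum to zero
    ([laplacian_frame_sum0]). The synthesis operator [T^*], where [T] is the
    analysis operator, has rank [N - 1] because the frame operator [S = T^* T]
    is invertible ([frame_op_unit], [synthesis_rank]); hence its kernel is a
    line, spanned by the all-ones vector ([ker_col_line]). Any linear relation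
    [c] among the frame vectors is therefore constant, say [c i = a] with
    [a != 0], so that the sum of squares is [N a^2 != 0] and each quotient
    [c i ^ 2 / (N a^2)] is [N^-1].

    On the other side, erasing all but the [i]th coefficient gives the rank-one
    operator [f |-> <f, f_i> S^-1 f_i], whose spectral radius is
    [|<S^-1 f_i, f_i>|] ([spectral_radius_rank1]). These inner products are the
    diagonal entries of [T S^-1 T^*], the orthogonal projection with kernel
    spanned by the all-ones vector; they all equal [1 - N^-1]
    ([cross_gram_diag]). All the complex powers thus have nonnegative real
    bases, where the principal power is the real one ([cpow_real]). *)

Local Open Scope sesquilinear_scope.
Local Open Scope ring_scope.

Section Modulus.
Variable R : realType.
Implicit Types (x p : R) (z : R[i]).

Lemma modulusE z : (modulus z)%:C%C = `|z|.
Proof. by rewrite /modulus normc_def. Qed.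

Lemma modulus_ge0 z : 0 <= modulus z.
Proof. by rewrite -ler0c modulusE normr_ge0. Qed.

Lemma modulus_real x : 0 <= x -> modulus x%:C%C = x.
Proof.
by move=> x0; apply/complexI; rewrite modulusE ger0_norm // ler0c.
Qed.

(** The hypothesis [p != 0] is needed at [x = 0], where the argument of [x] is
    [acos (0 / 0) = pi / 2] and the real power is [0 `^ 0 = 1]. *)
Lemma cpow_real x p : 0 <= x -> p != 0 -> cpow x%:C%C p = (x `^ p)%:C%C.
Proof.
move=> x0 p0; rewrite /cpow /carg modulus_real //= lexx.
have [->|xN0] := eqVneq x 0.
  by rewrite powR0 // !mul0r.
by rewrite divff // acos1 mulr0 cos0 sin0 mulr1 mulr0.
Qed.

End Modulus.

Section SpectralRadius.
Variable R : realType.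

(** The only possible nonzero eigenvalue of [u v] is the scalar [v u], with
    eigenvector [v] (eigenvectors act on the left). For [n = 0], both sides
    vanish. *)
Lemma spectral_radius_rank1 n (u : 'cV[R[i]]_n) (v : 'rV[R[i]]_n) :
  spectral_radius (u *m v) = modulus ((v *m u) 0 0).
Proof.
set t := (v *m u) 0 0; rewrite /spectral_radius.
have vu : v *m u = t%:M by rewrite [LHS]mx11_scalar.
have eig a : eigenvalue (u *m v) a -> a = 0 \/ a = t.
  case/eigenvalueP => x xE x0; have [->|a0] := eqVneq a 0; first by left.
  right; have xu : a *: (x *m u) = t *: (x *m u).
    by rewrite scalemxAl -xE !mulmxA -mulmxA vu mul_mx_scalar.
  have xu0 : x *m u != 0.
    apply: contraNneq x0 => xu0; move: xE; rewrite mulmxA xu0 mul0mx.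
    by move/esym/eqP; rewrite scaler_eq0 (negPf a0).
  apply/eqP; rewrite -subr_eq0; move/eqP: xu.
  by rewrite -subr_eq0 -scalerBl scaler_eq0 (negPf xu0) orbF.
have mod0 : modulus (0 : R[i]) = 0 by rewrite (_ : 0 = 0%:C)%C ?modulus_real.
set E := [set _ | _ in _]%classic.
have ubE : ubound E (modulus t).
  by move=> _ [a /eig[] -> <-]; rewrite ?mod0 ?modulus_ge0.
(* When [v u = 0], the set of moduli is empty or [{0}]. *)
have [t0|tN0] := eqVneq t 0.
  have /subset_set1[->|->] : (E `<=` [set modulus t])%classic.
  + by move=> _ [a /eig[] -> <-] /=; rewrite t0.
  + by rewrite sup0 t0 mod0.
  + by rewrite sup1.
have Et : E (modulus t).
  exists t => //; apply/eigenvalueP; exists v.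
    by rewrite mulmxA vu mul_scalar_mx.
  by apply: contraNneq tN0 => v0; rewrite /t v0 mul0mx mxE.
apply/le_anti/andP; split; first by apply: ge_sup => //; exists (modulus t).
by apply: ub_le_sup => //; exists (modulus t).
Qed.

End SpectralRadius.

Section LinearAlgebra.

Lemma adjmxM (C : numClosedFieldType) m n k
    (A : 'M[C]_(m, n)) (B : 'M[C]_(n, k)) :
  (A *m B)^t* = B^t* *m A^t*.
Proof. by rewrite trmx_mul map_mxM. Qed.

(** The kernel of a rank [N - 1] matrix is a line; for [N = 0] the hypothesis
    [v != 0] fails. *)
Lemma ker_col_line (K : fieldType) n N (B : 'M[K]_(n, N)) (u v : 'cV_N) :
  \rank B = N.-1 -> v != 0 -> B *m v = 0 -> B *m u = 0 ->
  exists a, u = a *: v.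
Proof.
move=> rB v0 Bv Bu.
have N0 : (0 < N)%N.
  by case: N B u v rB v0 {Bv Bu} => // B u v _; rewrite flatmx0 eqxx.
have rK : \rank (kermx B^T) = 1.
  by rewrite mxrank_ker mxrank_tr rB -subn1 subKn.
have sub w : B *m w = 0 -> (w^T <= kermx B^T)%MS.
  by move=> Bw; apply/sub_kermxP; rewrite -trmx_mul Bw trmx0.
have vT0 : v^T != 0 by rewrite -(inj_eq (@trmx_inj _ _ _)) trmxK trmx0.
have := mxrank_leqif_sup (sub _ v Bv); rewrite rank_rV vT0 rK => -[_ /esym].
rewrite eqxx => kv; have /sub_rVP[a ua] := submx_trans (sub _ u Bu) kv.
by exists a; rewrite -[u]trmxK ua linearZ /= trmxK.
Qed.

End LinearAlgebra.

Section FrameTheory.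
Variables (R : realType) (N n : nat).
Implicit Types (F : 'I_N -> 'cV[R[i]]_n) (f : 'cV[R[i]]_n).

(** The cross-Gramian [T S^-1 T^*] of a frame and its canonical dual, whose
    [(i, j)] entry is [<S^-1 f_j, f_i>]. When [S] is invertible, it is the
    orthogonal projection onto the range of the analysis operator [T]. *)
Definition cross_gram F : 'M[R[i]]_N :=
  analysis_mx F *m invmx (frame_op F) *m (analysis_mx F)^t*.

Lemma analysis_mx_col F f i : (analysis_mx F *m f) i 0 = dot f (F i).
Proof. by rewrite mxE; apply: eq_bigr => k _; rewrite mxE mulrC. Qed.

(** The adjoint of the analysis matrix is the synthesis matrix, with columns
    the vectors of [F]. *)
Lemma synthesis_mx_col F (c : 'I_N -> R[i]) :
  (analysis_mx F)^t* *m (\col_i c i) = \sum_i c i *: F i.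
Proof.
apply/colP => k; rewrite mxE summxE; apply: eq_bigr => i _.
by rewrite !mxE conjCK mulrC.
Qed.

Lemma frame_op_adj F : (frame_op F)^t* = frame_op F.
Proof. by rewrite adjmxM trmxCK. Qed.

Lemma dot_eq0 f : dot f f <= 0 -> f = 0.
Proof.
move=> f0; have {f0} : dot f f == 0.
  by rewrite eq_le f0 sumr_ge0 // => k _; rewrite -normCK exprn_ge0.
rewrite psumr_eq0 => [/allP f0|k _]; last by rewrite -normCK exprn_ge0.
apply/colP => k; rewrite mxE; have := f0 k; rewrite mem_index_enum.
by move=> /(_ isT); rewrite /= -normCK expf_eq0 normr_eq0 => /eqP.
Qed.

(** If [S f = 0] then the sum of the [|<f, f_i>|^2], which is [<S f, f>],
    vanishes, and [f = 0] by the lower frame bound. *)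
Lemma frame_op_unit F : is_frame F -> frame_op F \in unitmx.
Proof.
case=> A [B [A0 _ frF]]; rewrite unitmxE unitfE; apply/negP => /det0P[v v0 vS].
set f := v^t*; have /andP[frf _] := frF f; move: frf.
have -> : \sum_i `|dot f (F i)| ^+ 2 = 0.
  transitivity (((analysis_mx F *m f)^t* *m (analysis_mx F *m f)) 0 0).
    rewrite mxE; apply: eq_bigr => i _.
    by rewrite 2!mxE analysis_mx_col normCKC.
  by rewrite adjmxM trmxCK mulmxA -(mulmxA v) vS mul0mx mxE.
rewrite pmulr_rle0 ?ltcR // => /dot_eq0 f0; case/eqP: v0.
by rewrite -[v]trmxCK -/f f0 trmx0 map_mx0.
Qed.

(** No frame hypothesis is needed: [invmx] is total, and only the rank-one form
    of the erasure operators matters. *)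
Lemma E1_canonical_dual F (p : R) :
  E1 p F (canonical_dual F) =
  (N%:R^-1 * \sum_i modulus (cross_gram F i i) `^ p) `^ p^-1.
Proof.
rewrite /E1 /D1; congr ((_ * _) `^ _).
rewrite fsbig_image; last first.
  move=> i j _ _ /matrixP/(_ i i); rewrite !mxE eqxx andbb.
  by case: eqP => // _ /eqP; rewrite oner_eq0.
rewrite fsbig_finite //= (perm_big (index_enum 'I_N)) /=; last first.
  apply: uniq_perm; rewrite ?finmap.fset_uniq ?index_enum_uniq // => i.
  have setE := @in_fset_set _ [set: 'I_N]%classic finite_finset.
  by rewrite mem_index_enum setE in_setT.
apply: eq_bigr => i _; congr (_ `^ _).
have -> : (analysis_mx (canonical_dual F))^t* =
    invmx (frame_op F) *m (analysis_mx F)^t*.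
  apply/matrixP => k j; rewrite !mxE conjCK; apply: eq_bigr => l _.
  by rewrite !mxE conjCK.
(* [E_ii = e_i e_i^T] exhibits the erasure operator as a rank-one matrix. *)
rewrite -(mul_delta_mx (0 : 'I_1)) (mulmxA _ (delta_mx i 0)) -mulmxA.
rewrite spectral_radius_rank1 -rowE -colE; congr modulus.
by rewrite /cross_gram -mulmxA !mxE; apply: eq_bigr => k _; rewrite !mxE.
Qed.

Lemma synthesis_const F :
  (analysis_mx F)^t* *m const_mx 1 = \sum_i F i :> 'cV_n.
Proof.
under eq_bigr do rewrite -[F _]scale1r.
by rewrite -synthesis_mx_col; congr (_ *m _); apply/colP => j; rewrite !mxE.
Qed.

Lemma synthesis_rank F :
  frame_op F \in unitmx -> \rank ((analysis_mx F)^t*) = n.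
Proof.
move=> Su; apply/eqP; rewrite eqn_leq rank_leq_row /=.
by rewrite -{1}(mxrank_unit Su) mxrankM_maxl.
Qed.

(** [Q = 1 - T S^-1 T^*] is self-adjoint with columns in the kernel of [T^*],
    the line of constant vectors, so all the entries of [Q] are equal; as [Q]
    fixes the all-ones vector, they are all [N^-1]. *)
Lemma cross_gram_diag F (i : 'I_N) :
  frame_op F \in unitmx -> n = N.-1 -> \sum_j F j = 0 ->
  cross_gram F i i = 1 - N%:R^-1.
Proof.
move=> Su nN F0; set T := analysis_mx F; set Q := 1%:M - cross_gram F.
pose one : 'cV[R[i]]_N := const_mx 1.
have N0 : (0 < N)%N by apply: leq_ltn_trans (ltn_ord i).
have T1 : T^t* *m one = 0 by rewrite synthesis_const.
have one0 : one != 0.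
  by apply/eqP => /colP/(_ i)/eqP; rewrite !mxE oner_eq0.
have rT : \rank (T^t*) = N.-1 by rewrite synthesis_rank.
have TQ : T^t* *m Q = 0.
  by rewrite mulmxBr mulmx1 !mulmxA mulmxV // mul1mx subrr.
have Q1 : Q *m one = one.
  by rewrite mulmxBl mul1mx -mulmxA T1 mulmx0 subr0.
have Qadj : Q^t* = Q.
  rewrite raddfB /= map_mxB trmx1 map_mx1 !adjmxM trmxCK trmx_inv map_invmx.
  by rewrite frame_op_adj mulmxA.
have Qii : Q i i = 1 - cross_gram F i i.
  by rewrite /Q 3!mxE eqxx.
clearbody Q.
have Qcol j k : Q j k = Q i k.
  have [a Qa] : exists a, col k Q = a *: one.
    by apply: ker_col_line rT one0 T1 _; rewrite colE mulmxA TQ mul0mx.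
  have Qa' l : Q l k = a by have /colP/(_ l) := Qa; rewrite !mxE mulr1.
  by rewrite !Qa'.
have Qrow k : Q i k = Q i i.
  by rewrite -Qadj !mxE Qcol.
have : N%:R * Q i i = 1.
  have /colP/(_ i) := Q1; rewrite !mxE; apply: etrans.
  rewrite (eq_bigr (fun=> Q i i)) => [|k _]; last by rewrite Qrow mxE mulr1.
  by rewrite sumr_const card_ord mulr_natl.
move=> NQ; have N0' : N%:R != 0 :> R[i] by rewrite pnatr_eq0 -lt0n.
have : Q i i = N%:R^-1 by apply: (mulfI N0'); rewrite NQ mulfV.
by rewrite Qii => <-; rewrite subKr.
Qed.

End FrameTheory.

Section GraphFrameTheory.
Variables (R : realType) (N : nat).

Lemma laplacian_const (e : rel 'I_N) :
  laplacian R e *m const_mx 1 = 0 :> 'cV_N.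
Proof.
apply/colP => i; rewrite mulmxBl mul_diag_mx !mxE mulr1 /degree -sum1_card.
rewrite natr_sum big_mkcond /=; apply/eqP; rewrite subr_eq0; apply/eqP.
by apply: eq_bigr => j _; rewrite !mxE inE mulr1; case: (e i j).
Qed.

(** The sum of the frame vectors is [sqrt(diag lam) M_1^* 1]. Since
    [M diag(lam) M^*] kills the all-ones vector and [lam_1, ..., lam_n] are
    nonzero, [M_1^*] kills it too. *)
Lemma laplacian_frame_sum0 n (e : rel 'I_N) (F : 'I_N -> 'cV[R[i]]_n) :
  is_laplacian_frame e F -> \sum_i F i = 0.
Proof.
case=> _ _ [le_nN [lam [M [lamN0 Mu LE FE]]]].
pose one : 'cV[R[i]]_N := const_mx 1.
have lamM : diag_mx lam *m (M^t* *m one) = 0.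
  have MM : M^t* *m M = 1%:M by apply/mulmx1C/unitarymxP.
  have := congr1 (mulmx (M^t* )) (laplacian_const e).
  by rewrite LE mulmx0 !mulmxA MM mul1mx -mulmxA.
apply/colP => k; rewrite summxE mxE.
pose k' := widen_ord le_nN k.
have Mk : (M^t* *m one) k' 0 = 0.
  apply: (mulfI (_ : lam 0 k' != 0)); first by rewrite lamN0 /=.
  transitivity ((diag_mx lam *m (M^t* *m one)) k' 0).
    by rewrite mul_diag_mx [RHS]mxE.
  by rewrite lamM mxE mulr0.
rewrite -[RHS](mulr0 (sqrtC (lam 0 k'))) -[in RHS]Mk mxE mulr_sumr.
apply: eq_bigr => i _.
by rewrite FE -colE mxE mul_diag_mx !mxE mulr1.
Qed.

End GraphFrameTheory.

Theorem lemma5p8 (R : realType) (p : R) (N : nat) (e : rel 'I_N)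
    (F : 'I_N -> 'cV[R[i]]_(N.-1)) (c : 'I_N -> R[i]) :
  1 < p ->
  symmetric e -> irreflexive e -> graph_connected e ->
  is_laplacian_frame e F ->
  k_independent N.-1 F ->
  (exists i, c i != 0) ->
  \sum_(i < N) c i *: F i = 0 ->
  \sum_(j < N) c j ^+ 2 != 0 /\
  (E1 p F (canonical_dual F))%:C%C =
    cpow (N%:R^-1 *
          \sum_(i < N) cpow (1 - c i ^+ 2 / \sum_(j < N) c j ^+ 2) p) p^-1.
Proof.
move=> p1 _ _ _ LF _ [i0 ci0] cF.
have Su : frame_op F \in unitmx by case: LF => frF _ _; apply: frame_op_unit.
have F0 := laplacian_frame_sum0 LF.
have diag i := cross_gram_diag i Su erefl F0.
have N0 : (0 < N)%N by apply: leq_ltn_trans (ltn_ord i0).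
have p0 : p != 0 by rewrite gt_eqF // (lt_trans ltr01).
have [a cE] : exists a, forall i, c i = a.
  have rT : \rank ((analysis_mx F)^t*) = N.-1 by apply: synthesis_rank.
  have one0 : const_mx 1 != 0 :> 'cV[R[i]]_N.
    by apply/eqP => /colP/(_ i0)/eqP; rewrite !mxE oner_eq0.
  have [||a ca] := @ker_col_line _ _ _ _ (\col_i c i) _ rT one0.
  - by rewrite synthesis_const.
  - by rewrite synthesis_mx_col.
  by exists a => i; have /colP/(_ i) := ca; rewrite !mxE mulr1.
have a0 : a != 0 by rewrite -(cE i0).
have NC : N%:R != 0 :> R[i] by rewrite pnatr_eq0 -lt0n.
have sE : \sum_(j < N) c j ^+ 2 = N%:R * a ^+ 2.
  by rewrite (eq_bigr _ (fun j _ => congr1 (fun x => x ^+ 2) (cE j)))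
    sumr_const card_ord mulr_natl.
split; first by rewrite sE mulf_neq0 ?expf_neq0.
set x : R := 1 - N%:R^-1.
have x0 : 0 <= x by rewrite subr_ge0 invf_le1 ?ltr0n // ler1n.
have xE : x%:C%C = 1 - N%:R^-1 by rewrite rmorphB rmorph1 fmorphV rmorph_nat.
have NR : N%:R != 0 :> R by rewrite pnatr_eq0 -lt0n.
rewrite E1_canonical_dual.
rewrite (eq_bigr (fun=> x `^ p)) => [|i _]; last first.
  by rewrite diag -xE modulus_real.
rewrite [in RHS](eq_bigr (fun=> (x `^ p)%:C%C)) => [|i _]; last first.
  rewrite -cpow_real // xE sE cE; congr (cpow (1 - _) p).
  by rewrite invfM mulrCA mulfV ?expf_neq0 // mulr1.
rewrite !sumr_const !card_ord -(mulr_natl (x `^ p)) -(mulr_natl (x `^ p)%:C%C).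
by rewrite !mulKf // cpow_real ?powR_ge0 // invr_neq0.
Qed.
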